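(* For every $\epsilon>0$ there is a constant $C_\epsilon>0$ depending only on $\epsilon$ such that the following holds. Let $G$ be a connected graph with asymptotic growth rate $\mathrm{ar}(G)=\rho<\infty$. Then there exist $n\in\mathbb{N}$ with $n\le C_\epsilon\,\rho$, a map $f\colon V(G)\to\mathbb{Z}^n$, and constants $c>0$ and $R\ge 1$ (depending on $G$ and $\epsilon$) such that for all $u,v\in V(G)$, $$\|f(u)-f(v)\|_\infty\le\mathrm{dist}_G(u,v),$$ and $$\|f(u)-f(v)\|_\infty\ge c\,\mathrm{dist}_G(u,v)^{1-\epsilon}\quad\text{whenever }\mathrm{dist}_G(u,v)\ge R.$$
   Context: Graphs are undirected and simple, possibly infinite. $\mathrm{dist}_G$ is the graph metric and $B_G(u,r)$ is the closed ball of radius $r$ around $u$. The growth function is $\gamma_G(r)=\sup_{u\in V(G)}|B_G(u,r)|$; for $r\ge 1$ put $\rho(G,r)=\log\gamma_G(r)/\log(r+1)$. The asymptotic growth rate is $\mathrm{ar}(G)=\limsup_{r\to\infty}\rho(G,r)$. The metric $\|x-y\|_\infty$ on $\mathbb{Z}^n$ is the graph metric $\mathrm{dist}_\infty$ of the $n$-dimensional grid with diagonals (vertices $x,y\in\mathbb{Z}^n$ adjacent iff $\|x-y\|_\infty=1$). The asymptotic lower bound $\Omega_{G,\epsilon}(\cdot)$ is written out as: up to a constant $c>0$, for all sufficiently large distances. ($\mathbb{Z}^0$ is a single point.) *)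

(* Defs.v *)
From HB Require Import structures.
From mathcomp Require Import all_boot all_order all_algebra.
From mathcomp Require Import all_classical all_reals all_analysis.

Set Implicit Arguments.
Unset Strict Implicit.
Unset Printing Implicit Defensive.

Import Order.TTheory GRing.Theory Num.Theory.
Import numFieldNormedType.Exports.

Local Open Scope classical_set_scope.
Local Open Scope ring_scope.

(* The vertex type need not be finite. Requiring a [choiceType] and a boolean
   adjacency relation is no restriction, as [boolp] provides both classically. *)
Record sgraph := SGraph {
  vertex :> choiceType;
  edge : rel vertex;
  edge_sym : symmetric edge;
  edge_irr : irreflexive edge }.

Section GraphMetric.
Variable G : sgraph.
Implicit Types (u v : G) (n r : nat).

Definition walk u v n : Prop :=
  exists p : seq G, [/\ path (@edge G) u p, last u p = v & size p = n].

Definition reachable u v : Prop := exists n, walk u v n.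

Definition connected_graph : Prop := forall u v, reachable u v.

(* The junk value 0 is taken exactly when [v] is not reachable from [u]. *)
Definition gdist u v : nat :=
  xget 0%N [set n | walk u v n /\ forall m, walk u v m -> (n <= m)%N].

Definition gball u r : set G :=
  [set v | reachable u v /\ (gdist u v <= r)%N].

End GraphMetric.

Section Growth.
Variable R : realType.
Local Open Scope ereal_scope.

(* [counting] is +oo on infinite sets, so the growth function takes the value
   +oo when balls of radius [r] are infinite or of unbounded cardinality. *)
Definition growth (G : sgraph) (r : nat) : \bar R :=
  ereal_sup [set counting (gball u r) | u in [set: G]].

(* Only meaningful for 1 <= r; the value at r = 0 does not affect [ar]. *)
Definition growth_rate (G : sgraph) (r : nat) : \bar R :=
  lne (growth G r) / (ln (r.+1%:R : R))%:E.

Definition ar (G : sgraph) : \bar R := limn_esup (growth_rate G).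

End Growth.
Arguments ar R G : clear implicits.

(* Main.v *)
Require Import Defs.
From mathcomp Require Import all_boot all_order all_algebra.
From mathcomp Require Import all_classical all_reals all_analysis.
From mathcomp Require Import finmap.
From mathcomp Require Import zify ring lra.

Set Implicit Arguments.
Unset Strict Implicit.
Unset Printing Implicit Defensive.

Import Order.TTheory GRing.Theory Num.Theory.
Import numFieldNormedType.Exports.

(** Write |B(r)| for the largest size of a ball of radius r. If G has bounded
    diameter, n = 0 works. Otherwise balls contain geodesics, so that rho >= 1
    ([ar_ge1]), and |B(r)| <= (r + 1)^k for all large r, with an integer
    k <= 2 rho ([ar_growth_bound]).

    One scale. Fix a large integer t and put tau = t^p, s = t^(p+1),
    r = t^(p+3), D = t^(p+5). For N linear in k there are N maps
    f_j : G -> {0, ..., s}, each 1-Lipschitz, such that every pair (u, v) with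
    2r < d(u, v) <= D is separated by tau in some coordinate
    ([coordinates_at_scale]). They are found one after the other,
    deterministically. Give the pair (u, v) the weight t^(number of coordinates
    so far that fail to separate it), and the vertex u the total weight of the
    pairs (u, v) with d(u, v) <= D. Ball growing with respect to this weight
    ([carving]) produces clusters of radius at most r whose cores are more
    than s apart, and whose shells (the vertices outside the cores) carry at
    most a 1/t fraction of the weight; here s is short enough for t^2 steps of
    length s to fit in r, whereas the weight of a ball of radius r is below
    2^t. Choosing for each cluster a height in {0, ..., t - 1}, one cluster
    after the other, the pairs lying in two clusters of equal height carry at
    most a 1/t fraction of the weight too ([greedy_heights]). The new
    coordinate is the height times tau on each core, extended downwards with
    slope 1; it fails on at most a 4/t fraction of the weight
    ([coordinate_step]). These estimates are local: they compare a ball with a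
    slightly larger ball ([sum_clusters_le]). A coordinate therefore multiplies
    the local weight by at most 5, while each failure multiplies the weight of
    the failing pair by t. After N coordinates a pair on which all of them fail
    would have weight t^N, which exceeds the total weight
    5^N |B(t^(p+6))|^2 available around it ([separating_coordinates]).

    All scales. With P = q + 4 and T large, the scales t = T^((P + a) 9^i),
    0 <= a < 8P, handle all large distances ([scales_cover], with p = q + 1).
    For a fixed residue a the scales grow so fast, t_(i+1) = t_i^9, that the
    corresponding maps add up, with weights 1/t_i, to one 1-Lipschitz function
    which still separates by t_i^q / 2 the pairs separated at scale t_i
    ([sum_over_scales]). As these pairs have distance at most t_i^(q+6), the
    loss is an exponent q/(q+6) >= 1 - eps once 6 <= eps (q + 6). Taking
    integer parts gives a map to Z^n with n = 8P N = O(rho) for fixed eps. *)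

(** * Sums over sequences and sequential choice *)

Lemma sum_sub_uniq (T : eqType) (s1 s2 : seq T) (P1 P2 : pred T) (F : T -> nat) :
  uniq s1 -> uniq s2 -> (forall x, x \in s1 -> P1 x -> (x \in s2) && P2 x) ->
  \sum_(x <- s1 | P1 x) F x <= \sum_(x <- s2 | P2 x) F x.
Proof.
move=> us1 us2 sub.
rewrite -[X in X <= _]big_filter -[X in _ <= X]big_filter.
apply: (@uniq_sub_le_big _ addn leq leqnn (fun x y => leq_addr y x)); rewrite ?filter_uniq //.
by move=> x; rewrite !mem_filter => /andP[Px xs]; rewrite andbC sub.
Qed.

Lemma exchange_sum_seq (T U : Type) (s : seq T) (t : seq U) (P : T -> U -> bool)
    (F : T -> U -> nat) :
  \sum_(x <- s) \sum_(y <- t | P x y) F x y =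
  \sum_(y <- t) \sum_(x <- s | P x y) F x y.
Proof. exact: exchange_big_dep. Qed.

(** The value chosen at [z] may depend on the values chosen at the points of
    smaller index. *)
Section SequentialChoice.
Variables (G A : Type) (e : G -> nat) (P : (G -> A) -> G -> A -> Prop).

Lemma sequential_choice : A ->
  (forall h h' z a, (forall y, e y < e z -> h y = h' y) -> P h z a -> P h' z a) ->
  (forall h z, exists a, P h z a) -> exists h, forall z, P h z (h z).
Proof.
move=> a0 Ploc Pex.
have [c cP] : {c : (G -> A) -> G -> A & forall h z, P h z (c h z)}.
  have [f fP] := choice (fun hz : (G -> A) * G => Pex hz.1 hz.2).
  by exists (fun h z => f (h, z)) => h z; exact: (fP (h, z)).
pose H := fix H n : G -> A :=
  if n is n'.+1 then fun z => if e z == n' then c (H n') z else H n' z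
  else fun=> a0.
have HE y n : e y < n -> H n y = H (e y).+1 y.
  elim: n => // n IH; rewrite ltnS leq_eqVlt => /orP[/eqP <- //|lt_yn].
  by rewrite /= ifN ?IH //; apply/eqP => eyn; rewrite eyn ltnn in lt_yn.
exists (fun z => H (e z).+1 z) => z.
rewrite [H (e z).+1 z]/= eqxx.
by apply: Ploc (cP (H (e z)) z) => y lt_yz; rewrite HE.
Qed.

End SequentialChoice.

Lemma exists_minimal (T : Type) (e : T -> nat) (P : T -> Prop) :
  (exists x, P x) -> exists x, P x /\ forall y, e y < e x -> ~ P y.
Proof.
move=> [x Px]; have [n] := ubnP (e x); elim: n x Px => // n IH x Px lt_xn.
have [[y [lt_yx Py]]|noy] := pselect (exists y, e y < e x /\ P y).
  by apply: IH Py _; apply: leq_trans lt_yx _.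
by exists x; split=> // y lt_yx Py; apply: noy; exists y.
Qed.

(** * Ball growing and separating coordinates in a metric with finite balls *)

(** [ball x r] lists the closed ball of radius [r]; the injection [e] orders the
    points in the type of the natural numbers. *)
Section FiniteBalls.
Variables (G : eqType) (d : G -> G -> nat) (ball : G -> nat -> seq G).
Hypothesis dxx : forall x, d x x = 0.
Hypothesis dC : forall x y, d x y = d y x.
Hypothesis dtri : forall x y z, d x z <= d x y + d y z.
Hypothesis ball_uniq : forall x r, uniq (ball x r).
Hypothesis mem_ball : forall x r v, (v \in ball x r) = (d x v <= r).
Variable e : G -> nat.
Hypothesis e_inj : injective e.

(** Among the radii 0, s, ..., M s one is followed by a step in which the
    [w]-mass of the part of the ball lying in [U] grows by a factor at most
    1 + 1/b. *)
Lemma ball_growth (w : G -> nat) (U : pred G) (z : G) (s M b W : nat) :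
  0 < w z -> U z -> \sum_(v <- ball z (M * s)) w v <= W ->
  W * b ^ M < b.+1 ^ M ->
  exists i, [/\ i < M &
    b * \sum_(v <- ball z (M * s) | U v && (d z v <= i.+1 * s)) w v <=
    b.+1 * \sum_(v <- ball z (M * s) | U v && (d z v <= i * s)) w v].
Proof.
move=> wz Uz leW ltW.
pose m i := \sum_(v <- ball z (M * s) | U v && (d z v <= i * s)) w v.
apply: contrapT => noi.
have lt_m i : i < M -> b.+1 * m i <= b * m i.+1.
  move=> ltiM; rewrite leqNgt; apply/negP => lt; apply: noi; exists i.
  by split=> //; exact: ltnW.
have m0 : 0 < m 0.
  rewrite /m (big_rem z) /=; first by rewrite Uz dxx /=; lia.
  by rewrite mem_ball dxx.
have le_m i : i <= M -> b.+1 ^ i * m 0 <= b ^ i * m i.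
  elim: i => [//|i IH] ltiM; rewrite !expnS.
  have := IH (ltnW ltiM); have := lt_m _ ltiM.
  move: (b.+1 ^ i) (b ^ i) (m 0) (m i) (m i.+1) => X Y m0' mi mi' h1 h2.
  apply: (@leq_trans (b.+1 * (Y * mi))); first by rewrite -mulnA leq_mul2l h2 orbT.
  by rewrite mulnCA -mulnA [b * _]mulnCA leq_mul2l h1 orbT.
have mM : m M <= W.
  by apply: leq_trans leW; apply: sum_sub_uniq => // x xz _; rewrite xz.
have := le_m M (leqnn M); have : b ^ M * m M <= W * b ^ M by rewrite mulnC leq_mul2r mM orbT.
have : b.+1 ^ M <= b.+1 ^ M * m 0 by rewrite leq_pmulr.
lia.
Qed.

(** Each point [v] belongs to the cluster of its centre [c v], and is either in
    the core of that cluster or in its shell. *)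
Lemma carving (w : G -> nat) (s M b W : nat) :
  (forall v, 0 < w v) -> (forall z, \sum_(v <- ball z (M * s)) w v <= W) ->
  W * b ^ M < b.+1 ^ M ->
  exists (c : G -> G) (core : pred G),
    [/\ forall v, d (c v) v <= M * s,
        forall z,
          b * \sum_(v <- ball z (M * s) | (c v == z) && ~~ core v) w v <=
          \sum_(v <- ball z (M * s) | (c v == z) && core v) w v &
        forall u v, core u -> core v -> c u != c v -> s < d u v].
Proof.
move=> w_gt0 leW ltW.
(* [h z] is [None] when [z] is no centre, and [Some i] when the cluster of [z]
   has core radius i s and covers radius (i + 1) s. [U h z v] says that the
   centres of index smaller than that of [z] leave [v] uncovered. *)
pose U (h : G -> option nat) z v :=
  `[< forall y i, e y < e z -> h y = Some i -> i.+1 * s < d y v >].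
pose P (h : G -> option nat) z (a : option nat) :=
  if U h z z then exists i, [/\ a = Some i, i < M &
    b * \sum_(v <- ball z (M * s) | U h z v && (d z v <= i.+1 * s)) w v <=
    b.+1 * \sum_(v <- ball z (M * s) | U h z v && (d z v <= i * s)) w v]
  else a = None.
have Uloc h h' z v : (forall y, e y < e z -> h y = h' y) -> U h z v = U h' z v.
  move=> hh'; apply/asboolP/asboolP => Uv y i lt_yz.
    by rewrite -hh' //; exact: Uv.
  by rewrite hh' //; exact: Uv.
have [h hP] : exists h, forall z, P h z (h z).
  apply: (@sequential_choice _ _ e P None).
    move=> h h' z a hh'; rewrite /P (Uloc _ _ _ _ hh'); case: ifP => // _ [i [-> ltiM le]].
    exists i; split=> //; move: le; congr (_ * _ <= _ * _);
    by apply: eq_bigl => v; rewrite (Uloc _ _ _ _ hh').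
  move=> h z; rewrite /P; have [Uz|_] := boolP (U h z z); last by exists None.
  have [i [ltiM le]] := @ball_growth w (U h z) z s M b W (w_gt0 z) Uz (leW z) ltW.
  by exists (Some i), i.
pose cov v z := exists2 i, h z = Some i & d z v <= i.+1 * s.
have excov v : exists z, cov v z.
  have := hP v; rewrite /P; case: ifP => [_ [i [hv _ _]]|/negbT].
    by exists v, i => //; rewrite dxx.
  move=> /asboolPn NU _; apply: contrapT => nocov; apply: NU => y i lt_yv hy.
  by rewrite ltnNge; apply/negP => le; apply: nocov; exists y, i.
(* The first centre covering [v] is the one that removes it. *)
have [c cP] := choice (fun v => exists_minimal e (excov v)).
have cU v : U h (c v) v.
  apply/asboolP => y i lt_y hy; rewrite ltnNge; apply/negP => le.
  by have [_ /(_ y lt_y)] := cP v; apply; exists i.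
have c_eq v z i : h z = Some i -> (c v == z) = U h z v && (d z v <= i.+1 * s).
  move=> hz; apply/eqP/andP => [cv|[Uv le_zv]].
    rewrite -cv; split; first exact: cU.
    by have [[j hj lej] _] := cP v; move: hj lej; rewrite cv hz => -[<-].
  apply: e_inj; case: (ltngtP (e (c v)) (e z)) => // lt_e.
    have [[j hj lej] _] := cP v.
    by move/asboolP: Uv => /(_ _ _ lt_e hj); rewrite ltnNge lej.
  by have [_ /(_ z lt_e)] := cP v; case; exists i.
have P_some z i : h z = Some i -> i < M /\
    b * \sum_(v <- ball z (M * s) | U h z v && (d z v <= i.+1 * s)) w v <=
    b.+1 * \sum_(v <- ball z (M * s) | U h z v && (d z v <= i * s)) w v.
  by move=> hz; have := hP z; rewrite /P hz; case: ifP => // _ [j [[<-] ? ?]].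
exists c, (fun v => if h (c v) is Some i then d (c v) v <= i * s else false).
split.
- move=> v; have [[j hj lej] _] := cP v; apply: leq_trans lej _.
  by rewrite leq_mul2r (P_some _ _ hj).1 orbT.
- move=> z; case hz: (h z) => [i|]; last first.
    rewrite big_pred0 ?muln0 // => v; apply/negbTE/negP => /andP[/eqP cv _].
    by have [[j hj _] _] := cP v; rewrite cv hz in hj.
  have [ltiM le] := P_some _ _ hz.
  set shell := \sum_(v <- _ | (c v == z) && ~~ _) w v.
  set core := \sum_(v <- _ | _) w v.
  have leii v : d z v <= i * s -> d z v <= i.+1 * s by rewrite mulSn; lia.
  have coreE : \sum_(v <- ball z (M * s) | U h z v && (d z v <= i * s)) w v = core.
    apply: eq_bigl => v; case: eqP => [cv|/eqP ncv] /=.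
      have /eqP := cv; rewrite (c_eq _ _ _ hz) => /andP[-> _].
      by rewrite cv hz.
    apply/negbTE; move: ncv; rewrite (c_eq _ _ _ hz); apply: contra.
    by move=> /andP[-> /leii].
  have shellE : \sum_(v <- ball z (M * s) | U h z v && (d z v <= i.+1 * s)) w v
      = core + shell.
    rewrite /core /shell.
    rewrite (bigID (fun v => if h (c v) is Some i then d (c v) v <= i * s else false)) /=.
    by congr (_ + _); apply: eq_bigl => v; rewrite (c_eq _ _ _ hz).
  by move: le; rewrite shellE coreE mulnDr mulSn; lia.
- move=> u v; case hu: (h (c u)) => [i|//] leu; case hv: (h (c v)) => [j|//] lev ne.
  wlog lt_e : u v i j hu hv leu lev ne / e (c u) < e (c v).
    move=> W1; case: (ltngtP (e (c u)) (e (c v))) => [lt|gt|/e_inj cuv].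
    - exact: (W1 u v i j).
    - by rewrite dC; apply: (W1 v u j i); rewrite // eq_sym.
    - by rewrite cuv eqxx in ne.
  have /asboolP/(_ _ _ lt_e hu) := cU v.
  by have := dtri (c u) u v; rewrite mulSn; lia.
Qed.

(** When [z] receives its height, the pairs with [u] in the cluster of [z] and
    [v] in an earlier cluster are already split into [q] classes by the height
    of the latter; the height of [z] is that of the lightest class. *)
Lemma greedy_heights (q D r : nat) (c : G -> G) (p : G -> G -> nat) : 0 < q ->
  exists h : G -> 'I_q, forall z,
    q * \sum_(u <- ball z r | c u == z)
          \sum_(v <- ball u D | (e (c v) < e z) && (h (c v) == h z)) p u v <=
    \sum_(u <- ball z r | c u == z) \sum_(v <- ball u D) p u v.
Proof.
move=> q_gt0.
pose X (h : G -> 'I_q) z (a : 'I_q) := \sum_(u <- ball z r | c u == z)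
          \sum_(v <- ball u D | (e (c v) < e z) && (h (c v) == a)) p u v.
pose T z := \sum_(u <- ball z r | c u == z) \sum_(v <- ball u D) p u v.
apply: (@sequential_choice _ _ e (fun h z a => q * X h z a <= T z)).
- exact: (Ordinal q_gt0).
- move=> h h' z a hh'; congr (_ * _ <= _).
  apply: eq_bigr => u _; apply: eq_bigl => v.
  by case: ltnP => // lt_e; rewrite hh'.
move=> h z; apply: contrapT => noa.
have lt_a a : T z < q * X h z a.
  by rewrite ltnNge; apply/negP => le; apply: noa; exists a.
have leT : \sum_(a < q) X h z a <= T z.
  rewrite /X exchange_big /=; apply: leq_sum => u _.
  rewrite (exchange_big_dep xpredT) //=; apply: leq_sum => v _.
  case: (e (c v) < e z) => /=; last by rewrite big_pred0.
  by rewrite (big_pred1 (h (c v))) // => a; rewrite eq_sym.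
have [a0] : exists a0 : 'I_q, True by exists (Ordinal q_gt0).
suff : q * T z < q * \sum_(a < q) X h z a by rewrite ltnNge leq_mul2l leT orbT.
have -> : q * T z = \sum_(a < q) T z by rewrite sum_nat_const card_ord.
rewrite big_distrr /=.
apply: (@leq_ltn_trans (\sum_(a < q) (q * X h z a).-1)).
  by apply: leq_sum => a _; have := lt_a a; lia.
rewrite (bigD1 a0) // [ltnRHS](bigD1 a0) //= -addSn; apply: leq_add.
  by have := lt_a a0; lia.
by apply: leq_sum => a _; lia.
Qed.

(** An inequality valid on each cluster is valid on balls, provided that the
    ball on the right is enlarged by the diameter of a cluster. *)
Lemma sum_clusters_le (c : G -> G) (r t : nat) (x : G) (g1 g2 : G -> nat) :
  (forall v, d (c v) v <= r) ->
  (forall z, \sum_(v <- ball z r | c v == z) g1 v <=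
             \sum_(v <- ball z r | c v == z) g2 v) ->
  \sum_(v <- ball x t) g1 v <= \sum_(v <- ball x (t + r.*2)) g2 v.
Proof.
move=> c_near le12.
have byc (g : G -> nat) : \sum_(v <- ball x t) g v =
    \sum_(z <- ball x (t + r)) \sum_(v <- ball x t | c v == z) g v.
  rewrite -exchange_sum_seq big_seq [RHS]big_seq; apply: eq_bigr => v.
  rewrite mem_ball => dxv.
  rewrite (big_rem (c v)) /= ?eqxx; last first.
    by rewrite mem_ball; have := dtri x v (c v); have := c_near v; rewrite dC; lia.
  rewrite big_seq_cond big_pred0 ?addn0 // => z.
  rewrite rem_filter ?ball_uniq // mem_filter /= eq_sym.
  by case: eqP => //; rewrite andbF.
rewrite byc.
apply: (@leq_trans (\sum_(z <- ball x (t + r)) \sum_(v <- ball x (t + r.*2) | c v == z) g2 v)).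
  rewrite big_seq [leqRHS]big_seq; apply: leq_sum => z; rewrite mem_ball => dxz.
  apply: (@leq_trans (\sum_(v <- ball z r | c v == z) g1 v)).
    apply: sum_sub_uniq => // v _ /eqP cvz.
    by rewrite mem_ball cvz eqxx -cvz c_near.
  apply: leq_trans (le12 z) _; apply: sum_sub_uniq => // v.
  by rewrite !mem_ball => dzv ->; have := dtri x z v; lia.
rewrite -exchange_sum_seq; apply: leq_sum => v _.
rewrite -big_filter; have : uniq [seq z <- ball x (t + r) | c v == z].
  by rewrite filter_uniq.
have : {subset [seq z <- ball x (t + r) | c v == z] <= [:: c v]}.
  by move=> z; rewrite mem_filter inE eq_sym => /andP[].
move: [seq _ <- _ | _] => l sub ul.
have : size l <= 1 by exact: (uniq_leq_size ul sub).
by case: l {sub ul} => [|a [|b l]] //= _; rewrite ?big_nil ?big_seq1.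
Qed.

(** Exchanging the roles of the two points of a pair costs [D] in the radius. *)
Lemma sum_pairs_swap (x : G) (t D : nat) (Q : G -> G -> bool) (p : G -> G -> nat) :
  (forall u v, p u v = p v u) ->
  \sum_(u <- ball x t) \sum_(v <- ball u D | Q v u) p u v <=
  \sum_(v <- ball x (t + D)) \sum_(u <- ball v D | Q v u) p v u.
Proof.
move=> pC.
apply: (@leq_trans (\sum_(u <- ball x t) \sum_(v <- ball x (t + D) | (d u v <= D) && Q v u) p u v)).
  rewrite big_seq [leqRHS]big_seq; apply: leq_sum => u; rewrite mem_ball => dxu.
  apply: sum_sub_uniq => // v; rewrite !mem_ball => duv ->.
  by rewrite duv !andbT; have := dtri x u v; lia.
rewrite exchange_sum_seq; apply: leq_sum => v _.
rewrite (eq_bigr (fun u => p v u)) //.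
apply: sum_sub_uniq => // u _ /andP[duv Quv].
by rewrite mem_ball dC duv Quv.
Qed.

(** The function [f] takes values at least [tau] apart at [u] and [v]. Pairs at
    distance at most [r] count as separated: nothing is required of them. *)
Definition separates (r tau : nat) (f : G -> nat) (u v : G) : bool :=
  (r < d u v) ==> (f u + tau <= f v) || (f v + tau <= f u).

Lemma separatesC r tau f u v : separates r tau f u v = separates r tau f v u.
Proof. by rewrite /separates dC orbC. Qed.

(** One more coordinate, failing on at most a 4/b fraction of the [p]-mass of
    the pairs: one quarter each for [u] outside the cores, [v] outside the
    cores, and equal heights with [u] in the later or in the earlier cluster. *)
Lemma coordinate_step (p : G -> G -> nat) (tau b M D W : nat) : 0 < b ->
  (forall u v, 0 < p u v) -> (forall u v, p u v = p v u) ->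
  (forall z, \sum_(u <- ball z (M * (b * tau))) \sum_(v <- ball u D) p u v <= W) ->
  W * b ^ M < b.+1 ^ M ->
  exists f : G -> nat,
    [/\ forall u, f u <= b * tau,
        forall u v, f u <= f v + d u v &
        forall x t,
          b * \sum_(u <- ball x t)
                \sum_(v <- ball u D | ~~ separates (M * (b * tau)).*2 tau f u v) p u v <=
          4 * \sum_(u <- ball x (t + D + (M * (b * tau)).*2)) \sum_(v <- ball u D) p u v].
Proof.
move=> b_gt0 p_gt0 pC leW ltW.
set s := b * tau; set r := M * s; pose m u := \sum_(v <- ball u D) p u v.
have m_gt0 u : 0 < m u.
  by rewrite /m (big_rem u) /= ?mem_ball ?dxx // addn_gt0 p_gt0.
have [c [core [c_near shell sep]]] := carving m_gt0 leW ltW.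
have [h hP] := greedy_heights D r c p b_gt0.
pose f u := \max_(w <- ball u s | core w) (h (c w) * tau - d u w).
(* Heights are below [b], so that every value of [f] stays below the gap [s]
   between the cores. *)
have h_le z : h z * tau + tau <= s by rewrite -mulSnr leq_mul2r ltn_ord orbT.
have f_core u : core u -> f u = h (c u) * tau.
  move=> cu; apply/eqP; rewrite eqn_leq; apply/andP; split.
    apply/bigmax_leqP_seq => w; rewrite mem_ball => duw cw.
    have [->|ne] := eqVneq (c w) (c u); first exact: leq_subr.
    by have := sep _ _ cw cu ne; rewrite dC ltnNge duw.
  have := @leq_bigmax_seq _ (ball u s) core (fun w => h (c w) * tau - d u w) u.
  by rewrite mem_ball dxx subn0; apply.
exists f; split.
- move=> u; apply/bigmax_leqP_seq => w _ _; have := h_le (c w); lia.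
- move=> u v; apply/bigmax_leqP_seq => w _ cw.
  have := @leq_bigmax_seq _ (ball v s) core (fun w => h (c w) * tau - d v w) w.
  rewrite mem_ball -/(f v) => /(_ _ cw); have := h_le (c w).
  have := dtri v u w; rewrite (dC v u); move: (h (c w) * tau) (f v) => hw fv.
  case: (leqP hw (d v w)) => [|lt] d3 hws Hf; first lia.
  by have := Hf _; lia.
move=> x t.
pose same u v := (e (c v) < e (c u)) && (h (c v) == h (c u)).
have badP u v : ~~ separates r.*2 tau f u v ->
  [|| ~~ core u, ~~ core v, same u v | same v u].
  rewrite negb_imply => /andP[far nsep].
  case cu: (core u) => //=; case cv: (core v) => //=.
  move: nsep; rewrite (f_core _ cu) (f_core _ cv).
  have cuv : c u != c v.
    apply/eqP => cuv; have := dtri u (c u) v; have := c_near u; have := c_near v.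
    by rewrite -cuv (dC u (c u)); move: far; lia.
  have [hh|hh] := eqVneq (h (c u)) (h (c v)).
    rewrite /same hh eqxx !andbT; case: (ltngtP (e (c u)) (e (c v))) => // /e_inj ee.
    by rewrite ee eqxx in cuv.
  case: (ltngtP (h (c u)) (h (c v))) => [lt|lt|/val_inj ee].
  - by rewrite -mulSnr leq_mul2r lt orbT.
  - by rewrite -!mulSnr [_ <= _ * _]leq_mul2r [_ <= _ * _]leq_mul2r lt !orbT.
  - by rewrite ee eqxx in hh.
have mono :
  \sum_(u <- ball x (t + r.*2)) m u <= \sum_(u <- ball x (t + D + r.*2)) m u.
  by apply: sum_sub_uniq => // v; rewrite !mem_ball; lia.
have le1 a : b * \sum_(u <- ball x a) \sum_(v <- ball u D | ~~ core u) p u v <=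
    \sum_(u <- ball x (a + r.*2)) m u.
  rewrite big_distrr /=; apply: (@sum_clusters_le c r _ _ _ _ c_near) => z.
  rewrite -big_distrr /=.
  apply: (@leq_trans (\sum_(u <- ball z r | (c u == z) && core u) m u)); last first.
    by apply: sum_sub_uniq => // u -> /andP[->].
  apply: leq_trans (shell z); rewrite leq_mul2l [leqRHS]big_mkcondr /=.
  apply/orP; right; apply: leq_sum => u _.
  by case: (core u) => //=; rewrite big_pred0.
have le3 a : b * \sum_(u <- ball x a) \sum_(v <- ball u D | same u v) p u v <=
    \sum_(u <- ball x (a + r.*2)) m u.
  rewrite big_distrr /=; apply: (@sum_clusters_le c r _ _ _ _ c_near) => z.
  rewrite -big_distrr /=; apply: leq_trans (hP z); rewrite leq_mul2l.
  apply/orP; right; rewrite leq_eqVlt; apply/orP; left; apply/eqP.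
  by apply: eq_bigr => u /eqP <-.
have le2 : b * \sum_(u <- ball x t) \sum_(v <- ball u D | ~~ core v) p u v <=
    \sum_(u <- ball x (t + D + r.*2)) m u.
  by apply: leq_trans (le1 (t + D)); rewrite leq_mul2l;
    rewrite (@sum_pairs_swap x t D (fun v u => ~~ core v)) // orbT.
have le4 : b * \sum_(u <- ball x t) \sum_(v <- ball u D | same v u) p u v <=
    \sum_(u <- ball x (t + D + r.*2)) m u.
  by apply: leq_trans (le3 (t + D)); rewrite leq_mul2l (@sum_pairs_swap x t D same) // orbT.
pose S (Q : G -> G -> bool) := \sum_(u <- ball x t) \sum_(v <- ball u D | Q u v) p u v.
pose Y := \sum_(u <- ball x (t + D + r.*2)) m u.
have l1 : b * S (fun u v => ~~ core u) <= Y by apply: leq_trans (le1 t) mono.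
have l2 : b * S (fun u v => ~~ core v) <= Y by exact: le2.
have l3 : b * S same <= Y by apply: leq_trans (le3 t) mono.
have l4 : b * S (fun u v => same v u) <= Y by exact: le4.
suff le : S (fun u v => ~~ separates r.*2 tau f u v) <=
    S (fun u v => ~~ core u) + S (fun u v => ~~ core v) + S same + S (fun u v => same v u).
  apply: (@leq_trans (4 * Y)); last exact: leqnn.
  apply: leq_trans (leq_mul (leqnn b) le) _; rewrite !mulnDr.
  clearbody S Y; lia.
rewrite /S -!big_split /=; apply: leq_sum => u _.
rewrite big_mkcond [X in _ <= X + _ + _ + _]big_mkcond [X in _ <= _ + X + _ + _]big_mkcond.
rewrite [X in _ <= _ + _ + X + _]big_mkcond [X in _ <= _ + _ + _ + X]big_mkcond /=.
rewrite -!big_split /=; apply: leq_sum => v _.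
case: ifP => // /badP; move: (p u v) => k.
by case: (core u); case: (core v); case: (same u v); case: (same v u) => //= _; lia.
Qed.




(** The weight of a pair is [b] to the number of coordinates that fail to
    separate it. *)
Lemma separating_coordinates (N b tau M D W : nat) : 0 < b ->
  (forall x, 5 ^ N * \sum_(u <- ball x (M * (b * tau) + N * (D + (M * (b * tau)).*2)))
                       size (ball u D) <= W) ->
  W * b ^ M < b.+1 ^ M -> W < b ^ N ->
  exists f : nat -> G -> nat,
    [/\ forall j u, f j u <= b * tau,
        forall j u v, f j u <= f j v + d u v &
        forall u v, d u v <= D ->
          exists2 j, j < N & separates (M * (b * tau)).*2 tau (f j) u v].
Proof.
move=> b_gt0; set r := M * (b * tau); set D' := D + r.*2 => leW ltWM ltWN.
pose p (f : nat -> G -> nat) n u v :=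
  b ^ (\sum_(j < n) ~~ separates r.*2 tau (f j) u v).
pose m f n u := \sum_(v <- ball u D) p f n u v.
have [f [f_le f_lip f_mass]] : exists f : nat -> G -> nat,
    [/\ forall j u, f j u <= b * tau,
        forall j u v, f j u <= f j v + d u v &
        forall x t, \sum_(u <- ball x t) m f N u <=
          5 ^ N * \sum_(u <- ball x (t + N * D')) size (ball u D)].
  have: N <= N by [].
  elim: {-2}N => [_|n IH lt_nN].
    exists (fun _ _ => 0); split=> // x t.
    rewrite expn0 mul1n mul0n addn0; apply: leq_sum => u _.
    by rewrite /m /p -sum1_size; apply: leq_sum => v _; rewrite big_ord0.
  have [f [f_le f_lip f_mass]] := IH (ltnW lt_nN).
  have p_gt0 u v : 0 < p f n u v by rewrite expn_gt0 b_gt0.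
  have pC u v : p f n u v = p f n v u.
    by congr (_ ^ _); apply: eq_bigr => j _; rewrite separatesC.
  have massW z : \sum_(u <- ball z r) m f n u <= W.
    apply: leq_trans (f_mass z r) _; apply: leq_trans (leW z).
    apply: leq_mul; first by rewrite leq_pexp2l // ltnW.
    apply: sum_sub_uniq => // v; rewrite !mem_ball => le _.
    by rewrite andbT; apply: leq_trans le _; rewrite leq_add2l leq_mul2r (ltnW lt_nN) orbT.
  have [g [g_le g_lip g_mass]] := coordinate_step b_gt0 p_gt0 pC massW ltWM.
  exists (fun j => if j == n then g else f j); split.
  - by move=> j; case: ifP.
  - by move=> j; case: ifP.
  move=> x t; set f' := (fun j : nat => if j == n then g else f j).
  have pS u v : p f' n.+1 u v <= p f n u v +
      (if ~~ separates r.*2 tau g u v then b * p f n u v else 0).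
    rewrite /p big_ord_recr /= /f' eqxx expnD.
    rewrite (eq_bigr (fun j : 'I_n => nat_of_bool (~~ separates r.*2 tau (f j) u v))); last first.
      by move=> j _; rewrite ifN // neq_ltn ltn_ord.
    by case: (separates _ _ g u v); rewrite /= ?muln1 ?addn0 // expn1 mulnC leq_addl.
  apply: (@leq_trans (\sum_(u <- ball x t) m f n u +
    b * \sum_(u <- ball x t) \sum_(v <- ball u D | ~~ separates r.*2 tau g u v) p f n u v)).
    rewrite big_distrr -big_split /=; apply: leq_sum => u _.
    rewrite big_distrr [X in _ <= _ + X]big_mkcond -big_split /=.
    by apply: leq_sum => v _; exact: pS.
  have mono : \sum_(u <- ball x t) m f n u <= \sum_(u <- ball x (t + D')) m f n u.
    by apply: sum_sub_uniq => // v; rewrite !mem_ball; lia.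
  have := g_mass x t; rewrite -addnA -/D' => le4.
  apply: (@leq_trans (5 * \sum_(u <- ball x (t + D')) m f n u)).
    by rewrite (mulSn 4); apply: leq_add.
  rewrite expnS -mulnA leq_mul2l /= mulSn addnA.
  exact: f_mass.
exists f; split=> // u v duv; apply: contrapT => nsep.
have : p f N u v <= W.
  apply: leq_trans (leW u).
  apply: (@leq_trans (5 ^ N * \sum_(w <- ball u (0 + N * D')) size (ball w D))).
    apply: leq_trans (f_mass u 0).
    rewrite (big_rem u) ?mem_ball ?dxx //=; apply: leq_trans (leq_addr _ _).
    by rewrite /m (big_rem v) ?mem_ball //=; apply: leq_trans (leq_addr _ _).
  rewrite leq_mul2l; apply/orP; right; apply: sum_sub_uniq => // w.
  by rewrite !mem_ball; lia.
rewrite /p (eq_bigr (fun=> 1)) ?sum1_card ?card_ord => [|j _].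
  by rewrite leqNgt ltWN.
by case: (boolP (separates _ _ _ _ _)) => // sep; case: nsep; exists j.
Qed.

End FiniteBalls.

(** * A fixed number of coordinates at each scale *)

Lemma double_expn_le_expnS (b : nat) : 0 < b -> 2 * b ^ b <= b.+1 ^ b.
Proof.
move=> b_gt0; have bern n : b ^ n * (b + n) <= b.+1 ^ n * b.
  elim: n => [|n IH]; first by rewrite addn0.
  rewrite !expnS; apply: (@leq_trans (b.+1 * (b ^ n * (b + n)))).
    by move: (b ^ n) => x; nia.
  by rewrite -mulnA leq_mul2l IH orbT.
by have := bern b; rewrite -(leq_pmul2r b_gt0); nia.
Qed.

Lemma expn_lt_exp2 (N : nat) : exists T, forall t, T <= t -> t ^ N < 2 ^ t.
Proof.
case: N => [|N].
  by exists 1 => t t_gt0; rewrite expn0 -{1}(expn0 2) ltn_exp2l.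
exists (4 * (2 * N.+1) ^ N.+1) => t leTt.
set n := N.+1 in leTt *; pose a := t %/ (2 * n).
have n_gt0 : 0 < 2 * n by [].
have lt_t : t < a.+1 * (2 * n) by rewrite ltn_ceil.
have a_lt : a.+1 <= 2 ^ a by exact: ltn_expl.
apply: (@leq_ltn_trans ((2 ^ a * (2 * n)) ^ n)).
  by rewrite leq_exp2r // (leq_trans (ltnW lt_t)) // leq_mul2r a_lt orbT.
rewrite expnMn -expnM.
have a2 : a * n * 2 <= t.
  by have := leq_divM t (2 * n); rewrite -/a; lia.
apply: (@leq_trans (2 ^ (a * n) * 2 ^ ((2 * n) ^ n))).
  by rewrite ltn_pmul2l ?expn_gt0 // ltn_expl.
rewrite -expnD leq_exp2l //; lia.
Qed.

Section PolynomialGrowth.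
Variables (G : eqType) (d : G -> G -> nat) (ball : G -> nat -> seq G).
Hypothesis dxx : forall x, d x x = 0.
Hypothesis dC : forall x y, d x y = d y x.
Hypothesis dtri : forall x y z, d x z <= d x y + d y z.
Hypothesis ball_uniq : forall x r, uniq (ball x r).
Hypothesis mem_ball : forall x r v, (v \in ball x r) = (d x v <= r).
Variable e : G -> nat.
Hypothesis e_inj : injective e.

Lemma coordinates_at_scale (k r1 p : nat) (N := 2 * (k * (p + 6)) + 2) :
  (forall x r, r1 <= r -> size (ball x r) <= r.+1 ^ k) ->
  exists T, forall t, T <= t ->
    exists f : nat -> G -> nat,
    [/\ forall j u, f j u <= t ^ p.+1,
        forall j u v, f j u <= f j v + d u v &
        forall u v, 2 * t ^ (p + 3) < d u v <= t ^ (p + 5) ->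
          exists2 j, j < N & (f j u + t ^ p <= f j v) || (f j v + t ^ p <= f j u)].
Proof.
move=> growth; have [T0 T0P] := expn_lt_exp2 N.
(* The summands make t^N < 2^t, allow the growth bound at radius t, absorb the
   factor 5^N, and bound the radii r + N (D + 2r) by t^(p+6). *)
exists (T0 + r1 + 5 ^ N + 3 * N + 3) => t leTt.
have t_gt0 : 0 < t by lia.
have t_ge3 : 2 < t by lia.
set E := k * (p + 6).
have rE : t ^ 2 * (t * t ^ p) = t ^ (p + 3).
  by rewrite -expnS -expnD; congr (_ ^ _); lia.
have le_t a b : a <= b -> t ^ a <= t ^ b by move=> ?; rewrite leq_pexp2l.
have le35 : 3 * t ^ (p + 3) <= t ^ (p + 5).
  rewrite (_ : p + 5 = 2 + (p + 3)); last by lia.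
  rewrite (expnD t 2) leq_mul2r; apply/orP; right.
  by apply: leq_trans t_ge3 _; rewrite -{1}(expn1 t) le_t.
have r1_le a : t <= a -> r1 <= a by lia.
have le_t1 a : 0 < a -> t <= t ^ a by move=> ?; rewrite -{1}(expn1 t) le_t.
have S_le : (t ^ (p + 5)).+1 <= t ^ (p + 6).
  rewrite (_ : p + 6 = (p + 5).+1); last by lia.
  rewrite expnS.
  by have := le_t1 (p + 5) ltac:(lia); nia.
have card_D u : size (ball u (t ^ (p + 5))) <= t ^ E.
  apply: leq_trans (growth _ _ _) _; first by apply: r1_le; apply: le_t1; lia.
  rewrite /E mulnC expnM; case: (k) => // k'; by rewrite leq_exp2r.
set rho := t ^ (p + 3) + N * (t ^ (p + 5) + (t ^ (p + 3)).*2).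
have rho_le : rho.+1 <= t ^ (p + 6).
  rewrite (_ : p + 6 = (p + 5).+1); last by lia.
  rewrite expnS.
  have := le_t1 (p + 5) ltac:(lia).
  have : 3 * N + 2 <= t by lia.
  rewrite /rho; move: le35; move: (t ^ (p + 3)) (t ^ (p + 5)) => x y.
  by clear; nia.
have card_rho u : size (ball u rho) <= t ^ E.
  apply: leq_trans (growth _ _ _) _.
    by apply: r1_le; rewrite /rho; apply: leq_trans (leq_addr _ _); apply: le_t1; lia.
  rewrite /E mulnC expnM; case: (k) => // k'; by rewrite leq_exp2r.
(* Two balls contribute t^E each, and the factor 5^N one more power of t. *)
pose W := t ^ (2 * E + 1).
have ltWN : W < t ^ N by rewrite /W /N ltn_exp2l; lia.
have [||f [f1 f2 f3]] := @separating_coordinates G d ball dxx dC dtri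
    ball_uniq mem_ball e e_inj N t (t ^ p) (t ^ 2) (t ^ (p + 5)) W t_gt0 _ _ ltWN.
- move=> x; rewrite rE -/rho.
  apply: (@leq_trans (t * (t ^ E * t ^ E))); last first.
    by rewrite /W -expnD -expnS; apply: le_t; lia.
  apply: leq_mul; first by lia.
  apply: (@leq_trans (\sum_(u <- ball x rho) t ^ E)); first by apply: leq_sum.
  by rewrite big_const_seq count_predT iter_addn_0 mulnC leq_mul2r card_rho orbT.
- have W2 : W < 2 ^ t by apply: ltn_trans ltWN _; apply: T0P; lia.
  (* (1 + 1/t)^(t^2) >= 2^t *)
  have := double_expn_le_expnS t_gt0.
  rewrite -(leq_exp2r _ _ t_gt0) expnMn -!expnM mulnn => le2.
  by apply: leq_trans le2; rewrite ltn_pmul2r ?expn_gt0 ?t_gt0.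
exists f; split=> //; first by move=> j u; rewrite expnS.
move=> u v /andP[lt_d le_d]; have [j ltjN sep] := f3 u v le_d.
by exists j => //; move: sep; rewrite /separates rE -mul2n lt_d.
Qed.

End PolynomialGrowth.

(** * Summation over the scales *)

Local Open Scope classical_set_scope.
Local Open Scope ring_scope.

Lemma sum_inv_scales (R : realType) (t : nat -> nat) (m n : nat) :
  (forall i, (0 < t i)%N) -> (forall i, (2 * t i <= t i.+1)%N) -> (m <= n)%N ->
  \sum_(m <= i < n) (t i)%:R^-1 <= 2 * (t m)%:R^-1 :> R.
Proof.
move=> t_gt0 t2 lemn.
(* The negative term makes the induction on [n] telescope. *)
suff : \sum_(m <= i < n) (t i)%:R^-1 <= 2 * (t m)%:R^-1 - 2 * (t n)%:R^-1 :> R.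
  by move/le_trans; apply; rewrite gerBl mulr_ge0 ?invr_ge0.
elim: n lemn => [|n IH]; first by rewrite leqn0 => /eqP->; rewrite big_geq // subrr.
rewrite leq_eqVlt => /orP[/eqP <-|]; first by rewrite big_geq // subrr.
rewrite ltnS => lemn; rewrite big_nat_recr //=.
have := IH lemn.
have : 2 * (t n.+1)%:R^-1 <= (t n)%:R^-1 :> R.
  rewrite ler_pdivrMr ?ltr0n // mulrC ler_pdivlMr ?ltr0n // -natrM ler_nat; exact: t2.
lra.
Qed.

(** F is the sum of the (f_i - f_i(o)) / t_i. At scale i, the lower scales
    contribute little because f_j <= t_j^(q+2), and the higher ones because
    1/t_j is tiny compared to the distance. *)
Lemma sum_over_scales (R : realType) (G : Type) (o : G) (d : G -> G -> nat)
    (q : nat) (t : nat -> nat) (f : nat -> G -> nat) :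
  (0 < q)%N -> (1 < t 0)%N -> (forall i, t i.+1 = t i ^ 9)%N ->
  (forall x y, d x y = d y x) ->
  (forall i u, f i u <= t i ^ q.+2)%N ->
  (forall i u v, f i u <= f i v + d u v)%N ->
  exists F : G -> R,
    (forall u v, `|F u - F v| <= (d u v)%:R) /\
    (forall i u v, (d u v <= t i ^ (q + 6))%N ->
       (f i u + t i ^ q.+1 <= f i v)%N || (f i v + t i ^ q.+1 <= f i u)%N ->
       (t i)%:R ^+ q / 2 <= `|F u - F v|).
Proof.
move=> q_gt0 t0 tS dC f_le f_lip.
have t_gt1 i : (1 < t i)%N.
  elim: i => [|i IH] //.
  by rewrite tS; apply: (leq_trans IH); rewrite -{1}(expn1 (t i)) leq_exp2l //.
have t_gt0 i : (0 < t i)%N by exact: ltnW.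
have t2 i : (2 * t i <= t i.+1)%N.
  by rewrite tS (expnS _ 8) mulnC leq_mul2l (leq_trans (t_gt1 i)) ?orbT //;
    rewrite -{1}(expn1 (t i)) leq_exp2l.
have tR i : 0 < (t i)%:R :> R by rewrite ltr0n.
(* Without the normalization at [o] the series need not converge. *)
pose a u i : R := ((f i u)%:R - (f i o)%:R) / (t i)%:R.
have f_dist i u v : `|(f i u)%:R - (f i v)%:R| <= (d u v)%:R :> R.
  rewrite ler_norml lerBlDl lerNl opprB lerBlDr -!natrD !ler_nat.
  by rewrite f_lip [X in (_ <= X)%N]addnC dC f_lip.
have a_dist i u v : `|a u i - a v i| <= (d u v)%:R * (t i)%:R^-1.
  rewrite /a -mulrBl normrM normfV (gtr0_norm (tR i)) ler_wpM2r ?invr_ge0 //.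
  by rewrite opprB addrA subrK; exact: f_dist.
have t_pow i : (2 ^ i <= t i)%N.
  by elim: i => // i IH; rewrite expnS (leq_trans _ (t2 i)) // leq_mul2l IH orbT.
have a_cvg u : cvgn (series (a u)).
  apply: normed_cvg.
  apply: (@series_le_cvg R _ (geometric (d u o)%:R (2^-1))).
  - by move=> n; rewrite /=.
  - by move=> n; rewrite /= mulr_ge0 // exprn_ge0 // invr_ge0.
  - move=> n; rewrite /= (_ : a u n = a u n - a o n); last first.
      by rewrite /a subrr mul0r subr0.
    apply: le_trans (a_dist n u o) _; rewrite ler_wpM2l // exprVn.
    rewrite lef_pV2 ?posrE // ?exprn_gt0 // -natrX ler_nat; exact: t_pow.
  - apply: is_cvg_geometric_series; rewrite ger0_norm ?invr_ge0 //; lra.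
pose F u : R := limn (series (a u)).
have F_cvg u v : (fun n => `|series (a u) n - series (a v) n|) @ \oo --> `|F u - F v|.
  by apply: cvg_norm; apply: cvgB; exact: a_cvg.
have serE u v n : series (a u) n - series (a v) n = \sum_(0 <= i < n) (a u i - a v i).
  by rewrite /series /= sumrB.
have F_le M u v : (\forall n \near \oo, `|series (a u) n - series (a v) n| <= M) ->
    `|F u - F v| <= M.
  move=> H; rewrite -(cvg_lim (@Rhausdorff R) (F_cvg u v)).
  by apply: limr_le => //; apply: cvgP; exact: F_cvg.
have F_ge M u v : (\forall n \near \oo, M <= `|series (a u) n - series (a v) n|) ->
    M <= `|F u - F v|.
  move=> H; rewrite -(cvg_lim (@Rhausdorff R) (F_cvg u v)).
  by apply: limr_ge => //; apply: cvgP; exact: F_cvg.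
have sum_dist u v m n : (m <= n)%N ->
    \sum_(m <= i < n) `|a u i - a v i| <= (d u v)%:R * (2 * (t m)%:R^-1).
  move=> lemn; apply: (@le_trans _ _ ((d u v)%:R * \sum_(m <= i < n) (t i)%:R^-1)).
    by rewrite mulr_sumr; apply: ler_sum => i _; exact: a_dist.
  by rewrite ler_wpM2l // sum_inv_scales.
exists F; split=> [u v|i u v d_le sep].
  apply: F_le; apply: nearW => n; rewrite serE.
  apply: le_trans (ler_norm_sum _ _ _) _; apply: le_trans (sum_dist _ _ _ _ (leq0n n)) _.
  rewrite -[leRHS]mulr1 ler_wpM2l // ler_pdivrMr // mul1r ler_nat; exact: t0.
apply: F_ge; near=> n; rewrite serE.
have lt_in : (i < n)%N by near: n; exact: nbhs_infty_gt.
rewrite (big_cat_nat (n := i)) ?leq0n ?(ltnW lt_in) //= [X in _ + X]big_ltn //.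
set lo := \sum_(0 <= _ < i) _; set hi := \sum_(i.+1 <= _ < n) _.
have t8 : 8 * (t i)%:R ^+ 6 <= (t i.+1)%:R :> R.
  rewrite tS natrX (exprD _ 3 6) ler_wpM2r ?exprn_ge0 //.
  rewrite -natrX ler_nat (@leq_trans (2 ^ 3)%N) // leq_exp2r //.
have hi_le : `|hi| <= (t i)%:R ^+ q / 4.
  apply: le_trans (ler_norm_sum _ _ _) _; apply: le_trans (sum_dist _ _ _ _ lt_in) _.
  apply: (@le_trans _ _ ((t i)%:R ^+ (q + 6) * (2 * (t i.+1)%:R^-1))).
    by rewrite ler_wpM2r ?mulr_ge0 ?invr_ge0 // -natrX ler_nat.
  rewrite exprD -mulrA ler_wpM2l ?exprn_ge0 //.
  rewrite mulrA ler_pdivrMr //; lra.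
have lo_le : `|lo| <= (t i)%:R ^+ q / 4.
  have a_le j : `|a u j - a v j| <= (t j)%:R ^+ q.+1.
    rewrite /a -mulrBl opprB addrA subrK normrM normfV (gtr0_norm (tR j)).
    rewrite ler_pdivrMr // -exprSr -natrX.
    have := f_le j u; have := f_le j v; rewrite -!(ler_nat R).
    rewrite ler_norml; have := ler0n R (f j u); have := ler0n R (f j v); lra.
  apply: le_trans (ler_norm_sum _ _ _) _.
  apply: (@le_trans _ _ (\sum_(0 <= j < i) (t j)%:R ^+ q.+1)); first exact: ler_sum.
  have step j : 8 * (t j)%:R ^+ q.+1 <= (t j.+1)%:R ^+ q :> R.
    rewrite tS -!natrX -(natrM _ 8) ler_nat.
    apply: (@leq_trans (t j ^ 3 * t j ^ q.+1)%N).
      by rewrite leq_mul2r (@leq_trans (2 ^ 3)%N) ?orbT // leq_exp2r.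
    rewrite -expnD -expnM leq_exp2l //; lia.
  elim: (i) => [|j IH]; first by rewrite big_geq // divr_ge0 ?exprn_ge0.
  rewrite big_nat_recr //=; have := step j.
  have : (t j)%:R ^+ q <= (t j)%:R ^+ q.+1 :> R by rewrite ler_weXn2l // ler1n.
  have : 0 <= (t j)%:R ^+ q :> R by rewrite exprn_ge0.
  move: IH; lra.
have mid_ge : (t i)%:R ^+ q <= `|a u i - a v i|.
  rewrite /a -mulrBl opprB addrA subrK normrM normfV (gtr0_norm (tR i)).
  rewrite ler_pdivlMr // -exprSr -natrX.
  rewrite real_ler_normr ?num_real //.
  move: sep; rewrite -!(ler_nat R) !natrD.
  case/orP => H; apply/orP; [right|left]; lra.
have := ler_normB (lo + (a u i - a v i + hi)) (lo + hi).
rewrite (_ : lo + _ - (lo + hi) = a u i - a v i); last by ring.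
have := ler_normD lo hi; lra.
Unshelve. all: by end_near.
Qed.

(** The scales run through the exponents (P + a) 9^i with a < m = 8P, so that
    consecutive exponents have ratio at most 1 + 1/P; the exponent P 9^(i+1)
    follows (P + m - 1) 9^i because P + m = 9P. *)
Lemma scales_cover (P m T : nat) (t := (fun i => T ^ ((P + i %% m) * 9 ^ (i %/ m)))%N) :
  (1 < T)%N -> (0 < P)%N -> m = (8 * P)%N -> forall D, (2 * T ^ (P * P) < D)%N ->
  exists i, (2 * t i ^ P < D <= t i ^ P.+2)%N.
Proof.
move=> T_gt1 P_gt0 mP D ltD.
have m_gt0 : (0 < m)%N by lia.
have [n [nD n_min]] : exists n, (D <= 2 * t n ^ P)%N /\
    forall j, (j < n)%N -> ~ (D <= 2 * t j ^ P)%N.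
  have ex : exists n, (D <= 2 * t n ^ P)%N.
    exists (m * D)%N; rewrite /t modnMr addn0 mulKn //.
    apply: leq_trans (leq_pmull _ _) => //.
    apply: (@leq_trans (9 ^ D)%N); first by apply: ltnW; apply: ltn_expl.
    rewrite -expnM; apply: leq_trans (ltnW (ltn_expl _ T_gt1)).
    by rewrite mulnAC; apply: leq_pmull; rewrite muln_gt0 P_gt0.
  exists (ex_minn ex); case: ex_minnP => n nD n_min; split=> // j ltj /n_min; lia.
case: n => [|n] in nD n_min.
  by move: nD; rewrite /t mod0n div0n addn0 muln1 -expnM; lia.
exists n; have /negP := n_min n (ltnSn n); rewrite -ltnNge => -> /=.
apply: leq_trans nD _.
have e_step : (((P + n.+1 %% m) * 9 ^ (n.+1 %/ m)) = (P + (n %% m).+1) * 9 ^ (n %/ m))%N.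
  have := divn_eq n m; have := ltn_pmod n m_gt0.
  set r := (n %% m)%N; set i := (n %/ m)%N => ltr nE.
  rewrite nE -addnS; case: (ltnP r.+1 m) => ltr1.
    by rewrite modnMDl modn_small // divnMDl // divn_small // addn0.
  have -> : r.+1 = m by lia.
  rewrite -mulSnr mulnK // modnMl addn0 expnS mulnA; congr (_ * _)%N; lia.
rewrite /t e_step; set r := (n %% m)%N; set B := (9 ^ (n %/ m))%N.
have B_gt0 : (0 < B)%N by rewrite expn_gt0.
apply: (@leq_trans (T ^ 1 * (T ^ ((P + r.+1) * B)) ^ P)%N).
  by rewrite leq_mul2r expn1 T_gt1 orbT.
rewrite -!expnM -expnD leq_exp2l //.
have : (P * r.+1 <= P * r + P)%N by lia.
nia.
Qed.

(** The coordinates are indexed by the residue class of the scale and by the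
    number of the coordinate at that scale. *)
Lemma multiscale_coordinates (R : realType) (G : eqType) (d : G -> G -> nat)
    (ball : G -> nat -> seq G) (e : G -> nat) (o : G) (k r1 q : nat)
    (m := (8 * (q + 4))%N) (N := (2 * (k * (q + 7)) + 2)%N) :
  (forall x, d x x = 0%N) -> (forall x y, d x y = d y x) ->
  (forall x y z, d x z <= d x y + d y z)%N ->
  (forall x r, uniq (ball x r)) ->
  (forall x r v, (v \in ball x r) = (d x v <= r)%N) ->
  injective e -> (0 < q)%N ->
  (forall x r, (r1 <= r)%N -> (size (ball x r) <= r.+1 ^ k)%N) ->
  exists (F : 'I_m * 'I_N -> G -> R) (D0 : nat),
    (forall x u v, `|F x u - F x v| <= (d u v)%:R) /\
    (forall u v, (D0 < d u v)%N -> exists x s,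
      [/\ (4 <= s)%N, (d u v <= s ^ (q + 6))%N & s%:R ^+ q / 2 <= `|F x u - F x v|]).
Proof.
move=> dxx dC dtri ball_uniq mem_ball e_inj q_gt0 growth.
have [T0 HT0] := coordinates_at_scale dxx dC dtri ball_uniq mem_ball e_inj q.+1 growth.
rewrite !addSn -!addnS -/N in HT0.
pose good t (f : nat -> G -> nat) :=
  [/\ forall j u, (f j u <= t ^ q.+2)%N,
      forall j u v, (f j u <= f j v + d u v)%N &
      forall u v, (2 * t ^ (q + 4) < d u v <= t ^ (q + 6))%N ->
        exists2 j, (j < N)%N & (f j u + t ^ q.+1 <= f j v)%N ||
                               (f j v + t ^ q.+1 <= f j u)%N].
have [f0 f0P] : {f0 & forall t, (T0 <= t)%N -> good t (f0 t)}.
  apply: (@choice _ _ (fun t f => (T0 <= t)%N -> good t f)) => t.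
  have [le|lt] := leqP T0 t; last by exists (fun _ _ => 0%N).
  by have [f fP] := HT0 t le; exists f.
pose T := (T0 + 4)%N; have T_gt1 : (1 < T)%N by rewrite /T; lia.
have q4_gt0 : (0 < q + 4)%N by lia.
pose t (r i : nat) := (T ^ ((q + 4 + r) * 9 ^ i))%N.
have le_t r i : (T <= t r i)%N.
  rewrite /t -{1}(expn1 T) leq_exp2l // muln_gt0 expn_gt0 andbT; lia.
have le_T0 r i : (T0 <= t r i)%N by apply: leq_trans (le_t r i); rewrite /T; lia.
have exF (x : 'I_m * 'I_N) : exists F : G -> R,
    (forall u v, `|F u - F v| <= (d u v)%:R) /\
    (forall i u v, (d u v <= t x.1 i ^ (q + 6))%N ->
       (f0 (t x.1 i) x.2 u + t x.1 i ^ q.+1 <= f0 (t x.1 i) x.2 v)%N ||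
       (f0 (t x.1 i) x.2 v + t x.1 i ^ q.+1 <= f0 (t x.1 i) x.2 u)%N ->
       (t x.1 i)%:R ^+ q / 2 <= `|F u - F v|).
  apply: (@sum_over_scales R G o d q (t x.1) (fun i => f0 (t x.1 i) x.2)) => //.
  - exact: leq_trans (le_t _ _).
  - by move=> i; rewrite /t -expnM -mulnA -expnSr.
  - by move=> i u; have [H _ _] := f0P _ (le_T0 x.1 i).
  - by move=> i u v; have [_ H _] := f0P _ (le_T0 x.1 i).
have [F FP] := choice exF.
exists F, (2 * T ^ ((q + 4) * (q + 4)))%N; split=> [x u v|u v lt_d].
  exact: (FP x).1.
have [n] := scales_cover T_gt1 q4_gt0 (erefl m) lt_d.
rewrite -/(t (n %% m)%N (n %/ m)%N) -[(q + 4).+2]addn2 -addnA => n_d.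
have ltr : (n %% m < m)%N by rewrite ltn_pmod // /m; lia.
have [_ _ sep] := f0P _ (le_T0 (n %% m)%N (n %/ m)%N).
have [j ltjN sepj] := sep u v n_d.
exists (Ordinal ltr, Ordinal ltjN), (t (n %% m)%N (n %/ m)%N); split.
- by apply: leq_trans (le_t _ _); rewrite /T; lia.
- by case/andP: n_d.
- by apply: (FP (Ordinal ltr, Ordinal ltjN)).2 => //; case/andP: n_d.
Qed.

(** * The graph metric *)

Section GraphMetricTheory.
Variable G : sgraph.
Implicit Types u v w : G.

Lemma gdistP u v : reachable u v ->
  walk u v (gdist u v) /\ forall n, walk u v n -> (gdist u v <= n)%N.
Proof.
move=> ruv; apply: (@xgetPex _ 0%N [set n | walk u v n /\ forall m, walk u v m -> (n <= m)%N]).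
have [n [wn n_min]] := exists_minimal id ruv.
by exists n; split=> // m wm; rewrite leqNgt; apply/negP => /n_min.
Qed.

Lemma walk_refl u : walk u u 0.
Proof. by exists [::]. Qed.

Lemma walk_cat u v w m n : walk u v m -> walk v w n -> walk u w (m + n).
Proof.
move=> [p [p1 p2 <-]] [p' [p'1 p'2 <-]]; exists (p ++ p').
by rewrite cat_path p1 p2 p'1 last_cat p2 p'2 size_cat.
Qed.

Lemma walk_edge u v : edge u v -> walk u v 1.
Proof. by move=> uv; exists [:: v]; rewrite /= uv. Qed.

Lemma walk_sym u v n : walk u v n -> walk v u n.
Proof.
move=> [p [p1 p2 <-]]; elim: p u p1 p2 => [u _ /= <-|x p IH u /=].
  exact: walk_refl.
move=> /andP[ux xp] lastp; rewrite -addn1.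
by apply: walk_cat (IH x xp lastp) (walk_edge _); rewrite edge_sym.
Qed.

Hypothesis Gconn : connected_graph G.

Lemma gdist_le u v n : walk u v n -> (gdist u v <= n)%N.
Proof. exact: (gdistP (Gconn u v)).2. Qed.

Lemma gdist_walk u v : walk u v (gdist u v).
Proof. exact: (gdistP (Gconn u v)).1. Qed.

Lemma gdistxx u : gdist u u = 0%N.
Proof. by apply/eqP; rewrite -leqn0; apply/gdist_le/walk_refl. Qed.

Lemma gdistC u v : gdist u v = gdist v u.
Proof.
by apply/eqP; rewrite eqn_leq; apply/andP; split; apply: gdist_le;
  apply: walk_sym; exact: gdist_walk.
Qed.

Lemma gdist_triangle u v w : (gdist u w <= gdist u v + gdist v w)%N.
Proof. by apply: gdist_le; apply: walk_cat; exact: gdist_walk. Qed.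

Lemma gdist_intermediate u v n : (n <= gdist u v)%N -> exists w, gdist u w = n.
Proof.
move=> le_n; have [p [p1 p2 p3]] := gdist_walk u v.
exists (last u (take n p)); apply/eqP; rewrite eqn_leq.
have szt : size (take n p) = n by rewrite size_take p3; case: ltngtP le_n.
move: p1; rewrite -{1}(cat_take_drop n p) cat_path => /andP[pt pd].
apply/andP; split; first by rewrite -{2}szt; apply: gdist_le; exists (take n p).
have : (gdist (last u (take n p)) v <= gdist u v - n)%N.
  apply: gdist_le; exists (drop n p); split=> //; last by rewrite size_drop p3.
  by rewrite -last_cat cat_take_drop.
by have := gdist_triangle u (last u (take n p)) v; lia.
Qed.

Lemma gdist_lipschitz (g : G -> int) :
  (forall u v, edge u v -> `|g u - g v| <= 1) -> forall u v, `|g u - g v| <= (gdist u v)%:Z.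
Proof.
move=> g_edge u v; have [p [p1 <- <-]] := gdist_walk u v.
elim: p u p1 => [u _|x p IH u /= /andP[ux xp]]; first by rewrite subrr normr0.
have := IH x xp; have := g_edge _ _ ux; have := ler_distD (g x) (g u) (g (last x p)).
lia.
Qed.

End GraphMetricTheory.

(** * The asymptotic growth rate *)

Section GrowthTheory.
Variable R : realType.
Local Open Scope ereal_scope.

Lemma limn_esup_lt (u : nat -> \bar R) (a : \bar R) : limn_esup u < a ->
  exists n0, forall n, (n0 <= n)%N -> u n < a.
Proof.
move=> /ereal_inf_lt[_ [V [n0 _ n0V] <-] lt_a]; exists n0 => n le_n.
apply: le_lt_trans lt_a; apply: ereal_sup_ubound; exists n => //.
exact: n0V.
Qed.

Lemma limn_esup_ge (u : nat -> \bar R) (a : \bar R) n0 :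
  (forall n, (n0 <= n)%N -> a <= u n) -> a <= limn_esup u.
Proof.
move=> a_le; apply: le_ereal_inf_tmp => _ [V [n1 _ n1V] <-].
apply: le_trans (a_le (maxn n0 n1) (leq_maxl _ _)) _.
apply: ereal_sup_ubound; exists (maxn n0 n1) => //.
by apply: n1V => /=; exact: leq_maxr.
Qed.

Lemma counting_le_growth (G : sgraph) (u : G) r :
  counting (gball u r) <= growth R G r.
Proof. by apply: ereal_sup_ubound; exists u. Qed.

Lemma ln_succ_gt0 r : (0 < r)%N -> (0 < ln (r.+1%:R : R))%R.
Proof. by move=> r_gt0; rewrite ln_gt0 // ltr1n. Qed.

Lemma growth_rateE (G : sgraph) r : (0 < r)%N ->
  growth_rate R G r = lne (growth R G r) * ((ln (r.+1%:R : R))^-1)%:E.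
Proof. by move=> r_gt0; rewrite /growth_rate inver gt_eqF // ln_succ_gt0. Qed.

Lemma growth_le_pow (G : sgraph) (k r : nat) : (0 < r)%N ->
  growth_rate R G r < k%:R%:E -> growth R G r <= (r.+1 ^ k)%:R%:E.
Proof.
move=> r_gt0; rewrite growth_rateE // lte_pdivrMr ?ln_succ_gt0 //.
case: (growth R G r) => [x| |] //=; rewrite ?leNye //.
have [x_le0 _|x_gt0] := leP x 0%R.
  by rewrite lee_fin (le_trans x_le0).
rewrite -EFinM lte_fin lee_fin natrX mulrC mulr_natr -lnXn ?ltr0n // => lt.
by rewrite -ler_ln ?posrE ?exprn_gt0 ?ltr0n // ltW.
Qed.

Lemma growth_rate_ge (G : sgraph) (n r : nat) : (0 < r)%N ->
  (r.+1 ^ n)%:R%:E <= growth R G r -> n%:R%:E <= growth_rate R G r.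
Proof.
move=> r_gt0; rewrite growth_rateE // lee_pdivlMr ?ln_succ_gt0 //.
case: (growth R G r) => [x| |] //=; rewrite ?leey // lee_fin => le_x.
have x_gt0 : (0 < x)%R by apply: lt_le_trans le_x; rewrite ltr0n expn_gt0.
rewrite (lt_geF x_gt0) /= -EFinM lee_fin mulrC mulr_natr -lnXn ?ltr0n //.
by rewrite ler_ln ?posrE ?exprn_gt0 ?ltr0n // -natrX.
Qed.

Lemma counting_ge (T : choiceType) (A : set T) (s : seq T) :
  uniq s -> (forall x, x \in s -> A x) -> (size s)%:R%:E <= counting A :> \bar R.
Proof.
move=> us sA; rewrite /counting; case: asboolP => [Afin|_]; last exact: leey.
rewrite lee_fin ler_nat; apply: uniq_leq_size => // x xs.
by rewrite in_fset_set //; apply: mem_set; exact: sA.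
Qed.

(** The growth function of the empty graph is the supremum of the empty set, so
    that its asymptotic growth rate is -oo. *)
Lemma ar_inhabited (G : sgraph) (rho : R) : ar R G = rho%:E -> exists u : G, True.
Proof.
move=> arG; apply: contrapT => noG.
have gr r : (0 < r)%N -> growth_rate R G r = -oo.
  move=> r_gt0; rewrite growth_rateE // /growth (_ : [set _ | _ in _] = set0).
    by rewrite ereal_sup0 /= gt0_mulNye // lte_fin invr_gt0 ln_succ_gt0.
  by apply/seteqP; split=> x []// u _ _; apply: noG; exists u.
have : ar R G < rho%:E.
  apply: (@le_lt_trans _ _ -oo); last exact: ltNyr.
  apply: ereal_inf_lbound; exists [set n | (0 < n)%N]; first by exists 1%N.
  apply/eqP; rewrite -leeNy_eq; apply: ge_ereal_sup => _ [n n_gt0 <-].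
  by rewrite gr.
by rewrite arG ltxx.
Qed.

Lemma ar_ge0 (G : sgraph) (u : G) (rho : R) : connected_graph G ->
  ar R G = rho%:E -> (0 <= rho)%R.
Proof.
move=> conn arG; rewrite -lee_fin -arG; apply: (@limn_esup_ge _ _ 1) => r r_gt0.
apply: (@growth_rate_ge G 0) => //; apply: le_trans (counting_le_growth u r).
apply: (@counting_ge _ _ [:: u]) => // x; rewrite inE => /eqP ->.
by split; [exact: conn|rewrite gdistxx].
Qed.

Lemma ar_ge1 (G : sgraph) (rho : R) : connected_graph G ->
  (forall D : nat, exists u v : G, (D < gdist u v)%N) -> ar R G = rho%:E -> (1 <= rho)%R.
Proof.
move=> conn unb arG; rewrite -lee_fin -arG; apply: (@limn_esup_ge _ _ 1) => r r_gt0.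
apply: (@growth_rate_ge G 1) => //; have [u [v lt_r]] := unb r.
have [w wP] : {w : nat -> G & forall i, (i <= r)%N -> gdist u (w i) = i}.
  apply: (@choice _ _ (fun i x => (i <= r)%N -> gdist u x = i)) => i.
  have [le_i|] := leqP i r; last by exists u.
  have [|x xP] := @gdist_intermediate _ conn u v i; first by lia.
  by exists x.
apply: le_trans (counting_le_growth u r); rewrite expn1.
rewrite -(size_iota 0 r.+1) -(size_map w); apply: counting_ge.
  rewrite map_inj_in_uniq ?iota_uniq // => i j; rewrite !mem_iota !add0n !ltnS /=.
  by move=> /wP {2}<- /wP {2}<- ->.
move=> x /mapP[i]; rewrite mem_iota add0n ltnS /= => le_i ->.
by split; [exact: conn|rewrite wP].
Qed.

Lemma ar_growth_bound (G : sgraph) (rho : R) (k : nat) : ar R G = rho%:E -> (rho < k%:R)%R ->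
  exists r1, forall (u : G) r, (r1 <= r)%N ->
    finite_set (gball u r) /\ (size (fset_set (gball u r)) <= r.+1 ^ k)%N.
Proof.
move=> arG lt_k; have [|n0 n0P] := @limn_esup_lt (growth_rate R G) k%:R%:E.
  by rewrite -/(ar R G) arG lte_fin.
exists n0.+1 => u r le_r.
have := growth_le_pow (leq_trans (ltn0Sn n0) le_r) (n0P r (ltnW le_r)).
move/(le_trans (counting_le_growth u r)); rewrite /counting.
by case: asboolP => // fin; rewrite lee_fin ler_nat.
Qed.

End GrowthTheory.

(** * Assembling the embedding *)

Lemma injection_of_finite_balls (G : sgraph) (o : G) : connected_graph G ->
  (forall r, finite_set (gball o r)) -> exists e : G -> nat, injective e.
Proof.
move=> conn fin; have cG : countable [set: G].
  have -> : [set: G] = \bigcup_r gball o r.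
    by apply/seteqP; split=> // v _; exists (gdist o v) => //.
  apply: bigcup_countable; first exact: countableP.
  by move=> r _; exact: finite_set_countable (fin r).
have /countable_injP[e e_inj] := cG; exists e => x y exy.
by apply: e_inj exy; apply: mem_set.
Qed.

Lemma normrV_int_le n (x : 'rV[int]_n) (a : int) : 0 <= a ->
  (forall i, `|x ord0 i| <= a) -> `|x| <= a.
Proof.
move=> a_ge0 le_a; rewrite [leLHS]mx_normrE; apply: bigmax_le => // -[i j] _ /=.
by rewrite (ord1 i).
Qed.

Lemma normrV_int_ge n (x : 'rV[int]_n) i : `|x ord0 i| <= `|x|.
Proof. by rewrite [leRHS]mx_normrE; exact: (le_bigmax _ _ (ord0, i)). Qed.

Lemma floor_dist_le1 (R : realType) (x y : R) : `|x - y| <= 1 ->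
  `|Num.floor x - Num.floor y| <= 1.
Proof.
have floor_le1 (a b : R) : a <= b + 1 -> Num.floor a <= Num.floor b + 1.
  move=> le_ab; rewrite -(floor1 R) -floorDrz ?rpred1 //.
  exact: le_floor.
rewrite !ler_norml => /andP[h1 h2].
have := floor_le1 x y; have := floor_le1 y x.
move=> /(_ ltac:(lra)) H1 /(_ ltac:(lra)) H2; apply/andP; split; lia.
Qed.

Lemma floor_dist_ge (R : realType) (x y : R) :
  `|x - y| - 1 <= `|Num.floor x - Num.floor y|%:~R.
Proof.
rewrite intr_norm rmorphB /=.
have := floor_itv x; have := floor_itv y; rewrite !intrD.
move: (Num.floor x)%:~R (Num.floor y)%:~R => a b /andP[h1 h2] /andP[h3 h4].
have := ler_norm (a - b); have := ler_norm (b - a); rewrite (distrC b a).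
have [xy|yx] := leP y x; [rewrite (ger0_norm (x := x - y))|rewrite (ltr0_norm (x := x - y))]; lra.
Qed.

(** The final subtraction accounts for taking integer parts. *)
Lemma scale_lower_bound (R : realType) (eps : R) (q s d : nat) : 0 < eps ->
  6 <= eps * (q + 6)%:R -> (0 < q)%N -> (4 <= s)%N -> (0 < d <= s ^ (q + 6))%N ->
  4^-1 * d%:R `^ (1 - eps) <= s%:R ^+ q / 2 - 1.
Proof.
move=> eps_gt0 eps_q q_gt0 s4 /andP[d_gt0 d_le].
have s1 : 1 <= s%:R :> R by rewrite ler1n; lia.
have sq : 4 <= s%:R ^+ q :> R.
  rewrite -natrX ler_nat (leq_trans s4) // -{1}(expn1 s) leq_exp2l //; lia.
suff : d%:R `^ (1 - eps) <= s%:R ^+ q :> R by lra.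
have [le1|gt1] := leP (1 - eps) 0.
  apply: (@le_trans _ _ 1); last by lra.
  rewrite -[leRHS](powRr0 d%:R) ler_powR // ler1n; exact: d_gt0.
apply: (@le_trans _ _ ((s%:R ^+ (q + 6)) `^ (1 - eps))).
  by rewrite ge0_ler_powR ?nnegrE ?exprn_ge0 ?(ltW gt1) // -natrX ler_nat.
rewrite -!powR_mulrn // -powRrM ler_powR //.
rewrite mulrBr mulr1 mulrC natrD; move: eps_q; rewrite natrD; lra.
Qed.

Theorem corollary1p7 (R : realType) (eps : R) (heps : 0 < eps) :
  exists2 C : R, 0 < C &
    forall (G : sgraph) (rho : R),
      connected_graph G -> ar R G = rho%:E ->
      exists (n : nat) (f : G -> 'rV[int]_n) (c r0 : R),
        [/\ n%:R <= C * rho,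
            0 < c,
            1 <= r0,
            (forall u v : G, `|f u - f v| <= (gdist u v)%:Z) &
            (forall u v : G, r0 <= (gdist u v)%:R ->
               c * (gdist u v)%:R `^ (1 - eps) <= (`|f u - f v|)%:~R)].
Proof.
pose q := (Num.bound (6 / eps)).+1.
have q_gt0 : (0 < q)%N by [].
have eps_q : 6 <= eps * (q + 6)%:R.
  have := archi_boundP (divr_ge0 (ler0n R 6) (ltW heps)).
  rewrite ltr_pdivrMr // mulrC /q => lt; apply: le_trans (ltW lt) _.
  by rewrite ler_pM2l // ler_nat (leq_trans (leqnSn _)) // leq_addr.
pose m := (8 * (q + 4))%N.
exists (m * (4 * (q + 7) + 2))%:R => [|G rho conn arG].
  by rewrite ltr0n muln_gt0 /m; lia.
have [z0 _] := ar_inhabited arG.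
have rho_ge0 := ar_ge0 z0 conn arG.
have [[D0 D0P]|unb] := pselect (exists D0 : nat, forall u v : G, (gdist u v <= D0)%N).
  exists 0%N, (fun=> 0), 1, D0.+1%:R; split=> //.
  - by rewrite mulr_ge0.
  - by rewrite ler1n.
  - by move=> u v; rewrite subrr normr0.
  - by move=> u v; rewrite ler_nat ltnNge D0P.
have rho_ge1 : 1 <= rho.
  apply: ar_ge1 conn _ arG => D; apply: contrapT => noD; apply: unb; exists D => u v.
  by rewrite leqNgt; apply/negP => lt; apply: noD; exists u, v.
pose k := (Num.truncn rho).+1.
have [k_gt k_le] : rho < k%:R /\ k%:R <= 2 * rho.
  have := truncn_itv rho_ge0; rewrite -/k => /andP[le lt]; split=> //.
  by rewrite /k -natr1; lra.
have [r1 r1P] := ar_growth_bound arG k_gt.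
have fin (u : G) r : finite_set (gball u r).
  apply: sub_finite_set (r1P u (maxn r r1) (leq_maxr _ _)).1.
  by move=> v [ruv le_v]; split=> //; apply: leq_trans le_v (leq_maxl _ _).
have [e e_inj] := injection_of_finite_balls conn (fin z0).
pose ball (u : G) r : seq G := fset_set (gball u r).
have mem_ball u r v : (v \in ball u r) = (gdist u v <= r)%N.
  rewrite /ball in_fset_set //; apply/idP/idP => [/set_mem[] //|le_v].
  by apply: mem_set; split.
have [|F [D0 [F_lip F_sep]]] := @multiscale_coordinates R G (@gdist G) ball e z0 k r1 q
    (gdistxx conn) (gdistC conn) (gdist_triangle conn)
    (fun x r => fset_uniq _) mem_ball e_inj q_gt0.
  by move=> x r /(r1P x)[].
set N := (2 * (k * (q + 7)) + 2)%N in F F_lip F_sep.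
pose X : finType := ('I_m * 'I_N)%type.
pose f (u : G) : 'rV[int]_(#|X|) := \row_i Num.floor (F (enum_val i) u).
exists #|X|, f, 4^-1, D0.+1%:R; split=> //.
- rewrite card_prod !card_ord natrM natrM -mulrA ler_wpM2l //.
  rewrite /N !natrD !natrM !natrD; move: k_le; nra.
- by rewrite ler1n.
- move=> u v; apply: normrV_int_le => // i; rewrite !mxE.
  apply: (gdist_lipschitz conn (g := fun u => Num.floor (F (enum_val i) u))) => x y xy.
  apply: floor_dist_le1; apply: le_trans (F_lip _ _ _) _.
  by rewrite lern1; apply: gdist_le => //; exact: walk_edge.
- move=> u v; rewrite ler_nat => lt_d; have [x [s [s4 d_le sep]]] := F_sep u v lt_d.
  apply: le_trans (scale_lower_bound (q := q) (s := s) heps eps_q q_gt0 s4 _) _.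
    by rewrite d_le andbT; lia.
  apply: (@le_trans _ _ (`|F x u - F x v| - 1)); first by rewrite lerB.
  apply: le_trans (floor_dist_ge _ _) _; rewrite ler_int.
  apply: le_trans (normrV_int_ge (f u - f v) (enum_rank x)).
  by rewrite !mxE enum_rankK.
Qed.
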